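(* Let $r\ge 3$ and $l\ge r+2$ be integers. Let $G$ be a left-compressed $r$-uniform graph on the vertex set $[l]$ with edge set $E$ satisfying $|[l-2]^{(r-1)}\setminus E_l|\ge 2^{r-3}|E_{(l-1)l}|$. (a) If $G$ contains $[l-1]^{(r)}$, then $\lambda(G)=\lambda([l-1]^{(r)})$. (b) If $G$ does not contain $[l-1]^{(r)}$, then $\lambda(G)<\lambda([l-1]^{(r)})$.
   Context: An $r$-uniform graph ($r$-graph) $G$ on $[l]=\{1,\dots,l\}$ has edge set $E\subseteq[l]^{(r)}$, where $V^{(k)}$ denotes the family of $k$-element subsets of $V$ and $[n]^{(r)}$ also denotes the complete $r$-graph on $[n]$. For a vertex $i$, $E_i=\{A\in[l]^{(r-1)}: A\cup\{i\}\in E\}$ (the link of $i$); for vertices $i,j$, $E_{ij}=\{B\in[l]^{(r-2)}: B\cup\{i,j\}\in E\}$. For $\vec x\in S=\{\vec x\in\mathbb{R}^l:\sum_i x_i=1,\ x_i\ge0\}$, $\lambda(G,\vec x)=\sum_{i_1\cdots i_r\in E}x_{i_1}\cdots x_{i_r}$ and the Lagrangian is $\lambda(G)=\max_{\vec x\in S}\lambda(G,\vec x)$. $G$ is left-compressed if whenever $j_1\cdots j_r\in E$ and $i_k\le j_k$ for all $k$ (with $i_1,\dots,i_r$ distinct), then $i_1\cdots i_r\in E$. *)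

(* Defs.v *)
From mathcomp Require Import all_boot all_order all_algebra.
From mathcomp Require Import all_classical all_reals all_analysis.
Set Implicit Arguments.
Unset Strict Implicit.
Unset Printing Implicit Defensive.
Import Order.TTheory GRing.Theory Num.Theory numFieldNormedType.Exports.

Local Open Scope classical_set_scope.
Local Open Scope ring_scope.

(* Vertices are numbered from 0: the vertex i of [l] = {1, .., l} is the
   ordinal of value i - 1 in 'I_l.  A graph on [l] is given by its edge set. *)

(* V^(k) *)
Definition ksets (T : finType) (k : nat) (V : {set T}) : {set {set T}} :=
  [set A : {set T} | (A \subset V) && (#|A| == k)].

(* The complete r-graph [n]^(r), with vertex set exactly [n]. *)
Definition complete (n r : nat) : {set {set 'I_n}} := ksets r [set: 'I_n].

(* The subset [m] of [l], for m <= l. *)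
Definition initial (l m : nat) : {set 'I_l} := [set i : 'I_l | (i < m)%N].

Definition uniform (l r : nat) (E : {set {set 'I_l}}) : Prop :=
  E \subset complete l r.

(* For r-uniform E, cardinality forces i \notin A below, and likewise i, j \notin B
   and i != j in [link2]. *)
Definition link (l r : nat) (E : {set {set 'I_l}}) (i : 'I_l) :
    {set {set 'I_l}} :=
  [set A in ksets r.-1 [set: 'I_l] | A :|: [set i] \in E].

Definition link2 (l r : nat) (E : {set {set 'I_l}}) (i j : 'I_l) :
    {set {set 'I_l}} :=
  [set B in ksets r.-2 [set: 'I_l] | B :|: [set i; j] \in E].

Definition left_compressed (l r : nat) (E : {set {set 'I_l}}) : Prop :=
  forall i j : 'I_r -> 'I_l, injective i -> injective j ->
    (forall k, (i k <= j k)%N) ->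
    [set j k | k : 'I_r] \in E -> [set i k | k : 'I_r] \in E.

Section Lagrangian.
Variables (R : realType) (l : nat).
Implicit Types (E : {set {set 'I_l}}) (x : 'rV[R]_l).

Definition simplex : set 'rV[R]_l :=
  [set x | \sum_i x ord0 i = 1 /\ forall i, 0 <= x ord0 i].

Definition lagr_poly E x : R := \sum_(A in E) \prod_(i in A) x ord0 i.

(* For l > 0 this supremum is a maximum, see [lagrangian_max]. *)
Definition lagrangian E : R := sup [set lagr_poly E x | x in simplex].

Lemma lagr_poly_continuous E : continuous (lagr_poly E).
Proof.
apply: continuous_big => [|A _]; first exact: add_continuous.
apply: continuous_big => [|i _]; first exact: mul_continuous.
exact: coord_continuous.
Qed.

Lemma simplex_compact : compact simplex.
Proof.
apply: bounded_closed_compact.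
  exists 1; split => // M M1 x [x1 x0] /=.
  rewrite [`|x|]mx_normrE; apply: bigmax_le => [|[i j] _ /=].
    exact/ltW/(lt_trans ltr01).
  rewrite (ord1 i) ger0_norm //; apply/ltW; apply: le_lt_trans M1.
  by rewrite -x1 (bigD1 j) //= lerDl sumr_ge0.
have -> : simplex = (fun x : 'rV[R]_l => \sum_i x ord0 i) @^-1` [set 1]
    `&` \bigcap_(i in [set: 'I_l]) (fun x : 'rV[R]_l => x ord0 i) @^-1`
          [set y | 0 <= y].
  apply/seteqP; split => x [x1 x0]; split => // i; last exact: x0.
  by move=> _; exact: x0.
apply: closedI.
  apply: preimage_closed; last exact: closed_eq.
  move=> x _; apply: continuous_big => [|i _]; first exact: add_continuous.
  exact: coord_continuous.
apply: closed_bigI => i _; apply: preimage_closed; last exact: closed_ge.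
by move=> x _; exact: coord_continuous.
Qed.

Lemma lagrangian_max E : (0 < l)%N ->
  exists2 x, simplex x & lagrangian E = lagr_poly E x
    /\ forall y, simplex y -> lagr_poly E y <= lagr_poly E x.
Proof.
move=> l_gt0.
have simplex0 : simplex !=set0.
  pose i0 := Ordinal l_gt0; exists (delta_mx ord0 i0); split => [|i].
    rewrite (bigD1 i0) //= big1 ?addr0 ?mxE ?eqxx // => i /negPf i0F.
    by rewrite mxE i0F andbF.
  by rewrite mxE ler0n.
have [x xS xmax] := EVT_max_rV simplex0 simplex_compact
  (continuous_subspaceT (@lagr_poly_continuous E)).
rewrite inE in xS; exists x => //.
have {}xmax y : simplex y -> lagr_poly E y <= lagr_poly E x.
  by move=> yS; apply: xmax; rewrite inE.
split => //; apply/eqP; rewrite eq_le; apply/andP; split.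
  by apply: ge_sup => [|_ [y yS <-]]; [exists (lagr_poly E x), x | exact: xmax].
apply: ub_le_sup; last by exists x.
by exists (lagr_poly E x) => _ [y yS <-]; exact: xmax.
Qed.

End Lagrangian.

(* Main.v *)
(* First suppose that [E] contains all edges on the vertices before the last one,
   q, and let x be a maximiser.  If some coordinate vanishes, x is a weighting of
   a subgraph of a complete graph on l - 1 vertices.  Otherwise all partial
   derivatives agree at x.  Let p be the vertex before q, u = x_p, v = x_q, and let
   D be the set of non-edges of the link of q avoiding p.  Comparing the derivatives
   at p and q gives lambda(D, x) = (u - v) lambda(E_pq, x), and comparing those at
   i < p and p gives u <= x_i <= u + v.  If E_pq has k > 0 elements then v < u and
   lambda(D, x) >= 2^(r-3) k u^(r-1) > k (u - v) (u + v) (2u)^(r-3)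
                >= (u - v) lambda(E_pq, x),
   a contradiction; and if E_pq is empty then the weight of q can be moved to p.

   In general the first case applies to the graph obtained from [E] by adding the
   edges on the vertices before q.  Equality would force a maximiser x of [E] to have
   a zero coordinate i, the complement of i to be a clique, and then, by
   compression, the complement of q to be one. *)
Require Import Defs.
From mathcomp Require Import all_boot all_order all_algebra.
From mathcomp Require Import all_classical all_reals all_analysis.
From mathcomp Require Import ring lra zify.
Import Order.TTheory GRing.Theory Num.Theory.
Local Open Scope ring_scope.
Set Implicit Arguments.
Unset Strict Implicit.

(** * Weighted sums over families of sets and first-order conditions at a maximiser *)

Section WeightSums.
Variables (R : realType) (n : nat).
Implicit Types (x y : 'rV[R]_n) (P Q : pred {set 'I_n}) (E F : {set {set 'I_n}}).

Definition wsum x P : R := \sum_(A : {set 'I_n} | P A) \prod_(i in A) x ord0 i.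

(* Both sums leave out the sets containing [j], so that neither depends on the
   coordinates [i] and [j]. *)
Definition link_poly x E i j :=
  wsum x (fun A => [&& i \notin A, j \notin A & i |: A \in E]).

Definition link2_poly x E i j :=
  wsum x (fun A => [&& i \notin A, j \notin A & i |: (j |: A) \in E]).

Lemma weight_ge0 x (A : {set 'I_n}) :
  (forall i, 0 <= x ord0 i) -> 0 <= \prod_(i in A) x ord0 i.
Proof. by move=> x0; apply: prodr_ge0. Qed.

Lemma weight_gt0 x (A : {set 'I_n}) :
  (forall i, i \in A -> 0 < x ord0 i) -> 0 < \prod_(i in A) x ord0 i.
Proof. by move=> x0; apply: prodr_gt0. Qed.

Lemma wsum_ge0 x P : (forall i, 0 <= x ord0 i) -> 0 <= wsum x P.
Proof. by move=> x0; apply: sumr_ge0 => A _; exact: weight_ge0. Qed.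

Lemma eq_wsum x P Q : P =1 Q -> wsum x P = wsum x Q.
Proof. by move=> PQ; exact: eq_bigl. Qed.

Lemma wsum_bigID x P Q :
  wsum x P = wsum x (fun A => P A && Q A) + wsum x (fun A => P A && ~~ Q A).
Proof. by rewrite /wsum (bigID Q). Qed.

Lemma wsum_le x P Q : (forall i, 0 <= x ord0 i) -> (forall A, P A -> Q A) ->
  wsum x P <= wsum x Q.
Proof.
move=> x0 PQ; rewrite (wsum_bigID _ Q P).
rewrite (@eq_wsum _ (fun A => Q A && P A) P) => [|A]; last first.
  by case PA: (P A); rewrite ?andbF ?(PQ A).
by rewrite lerDl; exact: wsum_ge0.
Qed.

Lemma wsum_gt0 x P (A : {set 'I_n}) : (forall i, 0 <= x ord0 i) ->
  (forall i, i \in A -> 0 < x ord0 i) -> P A -> 0 < wsum x P.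
Proof.
move=> x0 xA PA; rewrite /wsum (bigD1 A) //= ltr_pwDl ?weight_gt0 //.
by apply: sumr_ge0 => B _; exact: weight_ge0.
Qed.

Lemma wsum_split x P i : wsum x P = wsum x (fun A => (i \notin A) && P A)
  + x ord0 i * wsum x (fun A => (i \notin A) && P (i |: A)).
Proof.
rewrite /wsum (bigID (fun A : {set 'I_n} => i \notin A)) /=; congr (_ + _).
  by apply: eq_bigl => A; rewrite andbC.
rewrite big_distrr /= (reindex_onto (fun B => i |: B) (fun A => A :\ i)) /=.
  apply: eq_big => [A|A /andP[/andP[_ _] /eqP AE]].
    rewrite setU11 andbT andbC; case iA: (i \in A) => /=; last first.
      by rewrite setU1K ?iA ?eqxx.
    by case: eqP => [/setP /(_ i)|]; rewrite ?andbF // !inE eqxx iA.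
  by rewrite big_setU1 //= -AE !inE eqxx.
by move=> A /andP[_]; rewrite negbK => iA; rewrite finset.setD1K.
Qed.

Lemma eq_wsum_off x y i j P : (forall k, k != i -> k != j -> x ord0 k = y ord0 k) ->
  (forall A, P A -> (i \notin A) && (j \notin A)) -> wsum x P = wsum y P.
Proof.
move=> xy Pij; apply: eq_bigr => A /Pij /andP[iA jA]; apply: eq_bigr => k kA.
by apply: xy; apply: contraTneq kA => ->.
Qed.

Lemma link2_poly_sym x E i j : link2_poly x E i j = link2_poly x E j i.
Proof. by apply: eq_wsum => A; rewrite andbCA finset.setUCA. Qed.

(** The polynomial has degree at most one in each coordinate, and the four coefficients involve
    neither [i] nor [j]; a transfer of weight between the two is thus a quadratic in the amount
    moved. *)
Lemma lagr_split x E i j : i != j -> lagr_poly E x =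
  wsum x (fun A => [&& i \notin A, j \notin A & A \in E])
  + x ord0 i * link_poly x E i j + x ord0 j * link_poly x E j i
  + x ord0 i * x ord0 j * link2_poly x E i j.
Proof.
move=> ij; rewrite [LHS](@wsum_split x (mem E) i).
rewrite (wsum_split _ (fun A => (i \notin A) && (A \in mem E)) j).
rewrite (wsum_split _ (fun A => (i \notin A) && (i |: A \in mem E)) j).
rewrite mulrDr mulrA -!addrA; congr (_ + _).
  by apply: eq_wsum => A; rewrite andbCA.
rewrite addrA addrCA -addrA; congr (_ * _ + (_ * _ + _ * _)); apply: eq_wsum => A.
- by rewrite andbCA.
- by rewrite in_setU1 (negPf ij).
- by rewrite in_setU1 (negPf ij) andbCA.
Qed.

Definition optimal E x := simplex x /\
  forall y, simplex y -> lagr_poly E y <= lagr_poly E x.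

Definition move_weight x i j (t : R) : 'rV[R]_n :=
  \row_k (x ord0 k + (k == j)%:R * t - (k == i)%:R * t).

Lemma move_weight_simplex x i j t : simplex x -> 0 <= t -> t <= x ord0 i ->
  simplex (move_weight x i j t).
Proof.
move=> [x1 x0] t0 ti; split => [|k].
  rewrite (eq_bigr _ (fun k _ => mxE _ _ _ _)) sumrB big_split /= x1.
  rewrite -!mulr_suml.
  have s1 (h : 'I_n) : \sum_k (k == h)%:R = 1 :> R.
    by rewrite (bigD1 h) //= eqxx big1 ?addr0 // => k /negPf ->.
  by rewrite !s1 addrK.
rewrite mxE; have := x0 k.
case: (k =P i) => [->|_]; case: (_ == _) => /=; rewrite ?mul0r ?mul1r; lra.
Qed.

Lemma lagr_move_weight x E i j t : i != j -> lagr_poly E (move_weight x i j t) =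
  wsum x (fun A => [&& i \notin A, j \notin A & A \in E])
  + (x ord0 i - t) * link_poly x E i j + (x ord0 j + t) * link_poly x E j i
  + (x ord0 i - t) * (x ord0 j + t) * link2_poly x E i j.
Proof.
move=> ij; rewrite (lagr_split _ _ ij).
have off k : k != i -> k != j -> move_weight x i j t ord0 k = x ord0 k.
  by move=> /negPf ki /negPf kj; rewrite mxE ki kj !mul0r addr0 subr0.
have -> : move_weight x i j t ord0 i = x ord0 i - t.
  by rewrite mxE eqxx (negPf ij) mul0r mul1r addr0.
have -> : move_weight x i j t ord0 j = x ord0 j + t.
  by rewrite mxE eqxx eq_sym (negPf ij) mul0r mul1r subr0.
rewrite /link_poly /link2_poly !(@eq_wsum_off (move_weight x i j t) x i j) // => A /and3P[iA jA _];
  by rewrite iA jA.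
Qed.

(* The one-sided first-order condition: moving weight from [i] to [j] cannot
   increase the polynomial, so its derivative along [i] is at least that along [j]. *)
Lemma optimal_deriv x E i j : optimal E x -> i != j -> 0 < x ord0 i ->
  link_poly x E j i + x ord0 i * link2_poly x E i j <=
  link_poly x E i j + x ord0 j * link2_poly x E i j.
Proof.
move=> [xS xmax] ij xi0; rewrite leNgt; apply/negP => lt.
have c0 : 0 <= link2_poly x E i j by apply: wsum_ge0; case: xS.
set a := link_poly x E i j in lt *; set b := link_poly x E j i in lt *.
set c := link2_poly x E i j in lt c0 *.
pose D := b + x ord0 i * c - (a + x ord0 j * c).
have D0 : 0 < D by rewrite subr_gt0.
(* Moving [t] changes the polynomial by [t * (D - t * c)]. The first bound keeps the point in the
   simplex; the second gives [t * c < D], with [c + 1] guarding against [c = 0]. *)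
pose t := Num.min (x ord0 i) (D / (c + 1)).
have c1 : 0 < c + 1 by lra.
have t0 : 0 < t by rewrite lt_min xi0 divr_gt0.
have tx : t <= x ord0 i by rewrite ge_min lexx.
have tc : t * (c + 1) <= D by rewrite -ler_pdivlMr // ge_min lexx orbT.
have := xmax _ (move_weight_simplex j xS (ltW t0) tx).
rewrite lagr_move_weight // (lagr_split _ _ ij) -/a -/b -/c => le.
have : 0 < t * (D - t * c) by apply: mulr_gt0 => //; lra.
by rewrite /D; move: le; set w := wsum _ _; nra.
Qed.

(** Weight can move in both directions, so the two one-sided conditions combine. *)
Lemma optimal_deriv_eq x E i j : optimal E x -> i != j ->
  0 < x ord0 i -> 0 < x ord0 j ->
  link_poly x E i j - link_poly x E j i = (x ord0 i - x ord0 j) * link2_poly x E i j.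
Proof.
move=> xo ij xi xj; have := optimal_deriv xo ij xi.
rewrite eq_sym in ij; have := optimal_deriv xo ij xj.
rewrite (link2_poly_sym _ _ j i) => h1 h2.
by apply/eqP; rewrite eq_le mulrBl; apply/andP; split; lra.
Qed.

Lemma optimal_lagrangian E x : optimal E x -> lagrangian R E = lagr_poly E x.
Proof.
move=> [xS xmax].
(* For [n = 0] the simplex is empty, as an empty sum is not 1. *)
have n0 : (0 < n)%N.
  case: (posnP n) => // n0; case: xS; rewrite big1 => [/eqP|i].
    by rewrite eq_sym oner_eq0.
  by have := ltn_ord i; rewrite {2}n0.
have [y yS [-> ymax]] := lagrangian_max R E n0.
by apply/eqP; rewrite eq_le xmax //= ymax.
Qed.

Lemma optimal_exists E : (0 < n)%N -> exists x, optimal E x.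
Proof. by move=> /(lagrangian_max R E)[x xS [_ xmax]]; exists x. Qed.

Lemma lagr_le x E F : (forall i, 0 <= x ord0 i) -> E \subset F ->
  lagr_poly E x <= lagr_poly F x.
Proof. by move=> x0 /fintype.subsetP EF; exact: wsum_le. Qed.

Lemma lagr_lt x E F : (forall i, 0 < x ord0 i) -> E \proper F ->
  lagr_poly E x < lagr_poly F x.
Proof.
move=> x0 /fintype.properP[/fintype.subsetP EF [A AF AE]].
have x0' i : 0 <= x ord0 i by exact: ltW.
rewrite [X in _ < X](wsum_bigID x (mem F) (mem E)).
rewrite [X in X < _](@wsum_bigID x (mem E) (mem F)).
have -> : wsum x (fun B => (B \in mem E) && ~~ (B \in mem F)) = 0.
  by apply: big1 => B /andP[/EF BF]; rewrite BF.
rewrite addr0 (@eq_wsum _ _ (fun A => (A \in mem F) && (A \in mem E))).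
  2: by move=> B; rewrite andbC.
by rewrite ltrDl; apply: (@wsum_gt0 _ _ A) => //=; rewrite AF.
Qed.

End WeightSums.

(** * Maximisers of complete graphs have positive coordinates *)

Lemma ex_kset (T : finType) k (V : {set T}) : (k <= #|V|)%N ->
  exists2 A : {set T}, A \subset V & #|A| = k.
Proof.
rewrite -bin_gt0 -cards_draws => /card_gt0P[A]; rewrite inE => /andP[AV /eqP Ak].
by exists A.
Qed.

Section Complete.
Variables (R : realType) (n r : nat).
Hypotheses (r2 : (2 <= r)%N) (rn : (r <= n)%N).

Lemma in_complete (A : {set 'I_n}) : (A \in complete n r) = (#|A| == r).
Proof. by rewrite !inE finset.subsetT. Qed.

Lemma lagrangian_complete_gt0 : 0 < lagrangian R (complete n r).
Proof.
have n0 : (0 < n)%N by lia.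
have [x xo] := optimal_exists R (complete n r) n0.
rewrite (optimal_lagrangian xo).
have n0R : 0 < n%:R :> R by rewrite ltr0n.
pose y : 'rV[R]_n := const_mx n%:R^-1.
have y0 i : 0 < y ord0 i by rewrite mxE invr_gt0.
have yS : simplex y.
  split => [|i]; last exact: ltW.
  rewrite (eq_bigr (fun=> n%:R^-1)) => [|i _]; last by rewrite mxE.
  by rewrite sumr_const card_ord -[LHS]mulr_natl divff // gt_eqF.
apply: lt_le_trans (xo.2 _ yS).
have [|A _ Ar] := @ex_kset _ r [set: 'I_n]; first by rewrite cardsT card_ord.
apply: (@wsum_gt0 _ _ _ (mem (complete n r)) A) => [i|//|]; first exact: ltW.
by rewrite /= in_complete Ar.
Qed.

(** Suppose [x] vanishes at [j], and take [i] in an edge [A] of positive weight. By symmetry the two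
    link polynomials agree, so the derivative along [j] exceeds that along [i] by [x ord0 i] times
    the pair link. This is positive, witnessed by [r - 2] other vertices of [A], against
    [optimal_deriv]. *)
Lemma optimal_complete_gt0 (x : 'rV[R]_n) :
  optimal (complete n r) x -> forall j, 0 < x ord0 j.
Proof.
move=> xo j; have [[x1 x0] xmax] := xo.
rewrite lt_neqAle x0 andbT; apply/eqP => /esym xj.
have [A Ar xA] : exists2 A : {set 'I_n}, A \in complete n r & 0 < \prod_(i in A) x ord0 i.
  have := lagrangian_complete_gt0; rewrite (optimal_lagrangian xo).
  rewrite /lagr_poly => /lt0r_neq0 /eqP; apply: contra_notP => nex.
  apply: big1 => A Ar; apply/eqP; rewrite eq_le weight_ge0 // andbT leNgt.
  by apply/negP => xA; apply: nex; exists A.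
have {}xA i : i \in A -> 0 < x ord0 i.
  move=> iA; rewrite lt_neqAle x0 andbT; apply/eqP => xi.
  by move: xA; rewrite (bigD1 i) //= -xi mul0r ltxx.
have Ar' : #|A| = r by apply/eqP; rewrite -in_complete.
have [i iA] : exists i, i \in A by apply/card_gt0P; rewrite Ar'; lia.
have jA : j \notin A by apply/negP => /xA; rewrite xj ltxx.
have ij : i != j by apply: contraNneq jA => <-.
have := optimal_deriv xo ij (xA i iA).
have -> : link_poly x (complete n r) j i = link_poly x (complete n r) i j.
  apply: eq_wsum => B; rewrite andbCA !in_complete !cardsU1.
  by case: (i \notin B) => //=; case: (j \notin B).
rewrite xj mul0r addr0 gerDl leNgt mulr_gt0 ?xA //.
have [|B BA Br] := @ex_kset _ (r - 2) (A :\ i).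
  by have := cardsD1 i A; rewrite iA Ar'; lia.
have iB : i \notin B.
  by apply/negP => /(fintype.subsetP BA); rewrite !inE eqxx.
have jB : j \notin B.
  by apply/negP => /(fintype.subsetP BA); rewrite !inE (negPf jA) andbF.
apply: (@wsum_gt0 _ _ _ _ B) => // [k /(fintype.subsetP BA)|].
  by rewrite !inE => /andP[_ /xA].
rewrite iB jB in_complete !cardsU1 !inE (negPf ij) iB jB Br /=; apply/eqP; lia.
Qed.

End Complete.

(** * Deleting and adding a vertex of weight zero *)

Section Restriction.
Variables (R : realType) (n r : nat) (i : 'I_n.+1).
Implicit Types (x : 'rV[R]_n.+1) (z : 'rV[R]_n) (E : {set {set 'I_n.+1}}).

(** The subgraph induced on the vertices other than [i], renumbered through [lift i]. *)
Definition restr E : {set {set 'I_n}} := [set B : {set 'I_n} | lift i @: B \in E].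

Lemma lift_preimset (A : {set 'I_n.+1}) : i \notin A -> lift i @: (lift i @^-1: A) = A.
Proof.
move=> iA; apply/setP => k; apply/imsetP/idP => [[h]|kA].
  by rewrite inE => hA ->.
have : i != k by apply: contraNneq iA => ->.
by case/unlift_some => h kh _; exists h; rewrite // inE -kh.
Qed.

Lemma imset_lift_notin (B : {set 'I_n}) : i \notin lift i @: B.
Proof. by apply/imsetP => -[h _ /eqP]; rewrite (negPf (neq_lift _ _)). Qed.

Lemma lagr_restr E x : x ord0 i = 0 ->
  lagr_poly E x = lagr_poly (restr E) (\row_k x ord0 (lift i k)).
Proof.
move=> xi; rewrite /lagr_poly (bigID (fun A : {set 'I_n.+1} => i \notin A)) /= addrC.
rewrite big1 ?add0r => [|A /andP[_]]; last first.
  by rewrite negbK => iA; rewrite (bigD1 i) //= xi mul0r.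
rewrite (reindex_onto (fun B : {set 'I_n} => lift i @: B) (fun A => lift i @^-1: A)) /=.
  apply: eq_big => [B|B _].
    rewrite imset_lift_notin andbT [in RHS]inE; case: (_ \in E) => //=.
    apply/eqP/setP => k; rewrite inE mem_imset //; exact: lift_inj.
  rewrite big_imset /=; last by move=> ? ? _ _; exact: lift_inj.
  by apply: eq_bigr => k _; rewrite mxE.
by move=> A /andP[_ iA]; exact: lift_preimset.
Qed.

Lemma restr_simplex x : simplex x -> x ord0 i = 0 ->
  simplex (\row_k x ord0 (lift i k)).
Proof.
move=> [x1 x0] xi; split => [|k]; last by rewrite mxE.
rewrite -x1 (bigD1_ord i) //= xi add0r; apply: eq_bigr => k _; by rewrite mxE.
Qed.

Lemma restr_uniform E : uniform r E -> restr E \subset complete n r.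
Proof.
move=> /fintype.subsetP Er; apply/fintype.subsetP => B; rewrite inE => /Er.
by rewrite !in_complete card_imset //; exact: lift_inj.
Qed.

Definition extend z : 'rV[R]_n.+1 := \row_k if unlift i k is Some h then z ord0 h else 0.

Lemma extend_i z : extend z ord0 i = 0.
Proof. by rewrite mxE unlift_none. Qed.

Lemma extend_restr z : \row_k extend z ord0 (lift i k) = z.
Proof. by apply/rowP => k; rewrite !mxE liftK. Qed.

Lemma extend_simplex z : simplex z -> simplex (extend z).
Proof.
move=> [z1 z0]; split => [|k]; last by rewrite mxE; case: unlift.
by rewrite (bigD1_ord i) //= extend_i add0r -z1; apply: eq_bigr => k _; rewrite mxE liftK.
Qed.

Lemma lagr_restr_le E x : uniform r E -> (0 < n)%N -> simplex x ->
  x ord0 i = 0 -> lagr_poly E x <= lagrangian R (complete n r).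
Proof.
move=> Er n0 xS xi; have [z zo] := optimal_exists R (complete n r) n0.
have yS := restr_simplex xS xi.
rewrite (optimal_lagrangian zo) lagr_restr //.
apply: le_trans (zo.2 _ yS); apply: lagr_le; first by case: yS.
exact: restr_uniform.
Qed.

(** A maximiser of the complete graph, extended by zero at [i], keeps its value. *)
Lemma lagrangian_ge_complete E : (0 < n)%N ->
  (forall A : {set 'I_n.+1}, i \notin A -> #|A| = r -> A \in E) ->
  lagrangian R (complete n r) <= lagrangian R E.
Proof.
move=> n0 EK; have [z zo] := optimal_exists R (complete n r) n0.
have [x xo] := optimal_exists R E (ltn0Sn _).
rewrite (optimal_lagrangian zo) (optimal_lagrangian xo).
have zS := zo.1; apply: le_trans (xo.2 _ (extend_simplex zS)).
rewrite lagr_restr ?extend_i // extend_restr; apply: lagr_le; first by case: zS.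
apply/fintype.subsetP => B; rewrite in_complete inE => /eqP Br.
by apply: EK; rewrite ?imset_lift_notin // card_imset //; exact: lift_inj.
Qed.

(* A maximiser vanishing at [i] restricts to a maximiser of the complete graph,
   whose entries are positive; hence no edge off [i] may be missing. *)
Lemma clique_of_lagrangian_ge E x : uniform r E -> (2 <= r)%N -> (r <= n)%N ->
  simplex x -> x ord0 i = 0 -> lagrangian R (complete n r) <= lagr_poly E x ->
  forall A : {set 'I_n.+1}, i \notin A -> #|A| = r -> A \in E.
Proof.
move=> Er r2 rn xS xi; have n0 : (0 < n)%N by lia.
have [z zo] := optimal_exists R (complete n r) n0.
have yS := restr_simplex xS xi.
rewrite (optimal_lagrangian zo) lagr_restr //; set y := \row_k _ => le.
have yE : lagr_poly (restr E) y <= lagr_poly (complete n r) y.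
  by apply: lagr_le; [case: yS | exact: restr_uniform].
have yo : optimal (complete n r) y.
  split => // w wS; apply: le_trans (zo.2 _ wS) _; exact: le_trans le yE.
have y0 := optimal_complete_gt0 r2 rn yo.
move=> A iA Ar; apply/negPn/negP => AE.
suff : lagr_poly (restr E) y < lagr_poly (complete n r) y.
  by rewrite ltNge (le_trans _ le) // zo.2.
apply: lagr_lt => //; apply/fintype.properP; split; first exact: restr_uniform.
exists (lift i @^-1: A); last by rewrite inE lift_preimset.
by rewrite in_complete -(card_imset _ (@lift_inj _ i)) lift_preimset // Ar.
Qed.

End Restriction.

(** * Links and compression *)

Lemma in_link (l r : nat) (E : {set {set 'I_l}}) i A :
  (A \in link r E i) = (#|A| == r.-1) && (i |: A \in E).
Proof. by rewrite inE in_complete finset.setUC. Qed.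

Lemma in_link2 (l r : nat) (E : {set {set 'I_l}}) i j A :
  (A \in link2 r E i j) = (#|A| == r.-2) && (i |: (j |: A) \in E).
Proof. by rewrite inE in_complete finset.setUC finset.setUA. Qed.

(* A set [A] of size [r] enumerates as an injection ['I_r -> 'I_l]; changing
   its value [j] into [i] gives the pointwise smaller injection. *)
Lemma left_compressed_swap (l r : nat) (E : {set {set 'I_l}}) (i j : 'I_l) (A : {set 'I_l}) :
  uniform r E -> left_compressed r E -> (i <= j)%N -> i \notin A -> j \notin A ->
  j |: A \in E -> i |: A \in E.
Proof.
move=> /fintype.subsetP Er lc ij iA jA jAE.
have cA : #|j |: A| = r by apply/eqP; rewrite -in_complete; exact: Er.
pose f (k : 'I_r) : 'I_l := enum_val (cast_ord (esym cA) k).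
pose g (k : 'I_r) : 'I_l := if f k == j then i else f k.
have finj : injective f.
  by move=> k h /enum_val_inj /cast_ord_inj.
have fA k : f k != j -> f k \in A.
  by move=> /negPf fj; have := enum_valP (cast_ord (esym cA) k); rewrite in_setU1 -/(f k) fj.
have fim : [set f k | k : 'I_r] = j |: A.
  apply/setP => h; apply/imsetP/idP => [[k _ ->]|hA]; first exact: enum_valP.
  exists (cast_ord cA (enum_rank_in hA h)) => //.
  by rewrite /f cast_ordK enum_rankK_in.
have gfim : [set g k | k : 'I_r] = i |: A.
  apply/setP => h; apply/imsetP/idP => [[k _ ->]|].
    by rewrite /g; case: ifPn => [|/fA fkA]; rewrite !inE ?eqxx // fkA orbT.
  rewrite in_setU1 => /orP[/eqP ->|hA].
    have : j \in [set f k | k : 'I_r] by rewrite fim setU11.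
    by case/imsetP => k _ jk; exists k; rewrite // /g -jk eqxx.
  have : h \in [set f k | k : 'I_r] by rewrite fim in_setU1 hA orbT.
  case/imsetP => k _ hk; exists k => //; rewrite /g -hk.
  by case: eqP => // hj; rewrite hj (negPf jA) in hA.
rewrite -gfim; apply: (lc g f) => //; last by rewrite fim.
  (* As [i] is not in [A], the new value collides with none of the others. *)
  move=> k h; rewrite /g; case: ifPn => [/eqP fk|/fA fk]; case: ifPn => [/eqP fh|/fA fh].
  - by move=> _; apply: finj; rewrite fk fh.
  - by move=> ih; rewrite -ih (negPf iA) in fh.
  - by move=> ki; rewrite ki (negPf iA) in fk.
  - exact: finj.
by move=> k; rewrite /g; case: ifPn => [/eqP ->|].
Qed.

(** * The last two vertices at a maximiser with positive coordinates *)

Section LastTwoVertices.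
Variables (R : realType) (n r : nat) (E : {set {set 'I_n.+1}}) (p q : 'I_n.+1).
Hypotheses (r3 : (3 <= r)%N) (rn : (r < n)%N) (Er : uniform r E)
  (lc : left_compressed r E) (pE : p = n.-1 :> nat) (qE : q = n :> nat)
  (EK : forall A : {set 'I_n.+1}, q \notin A -> #|A| = r -> A \in E).
Variable x : 'rV[R]_n.+1.
Hypotheses (xo : optimal E x) (x0 : forall i, 0 < x ord0 i).

Let x0' i : 0 <= x ord0 i. Proof. exact: ltW. Qed.
Let pq : p != q. Proof. by apply/eqP => /(congr1 val) /=; lia. Qed.

Lemma card_edge A : A \in E -> #|A| = r.
Proof. by move=> /(fintype.subsetP Er); rewrite in_complete => /eqP. Qed.

(** Since [r < n], there is room for [r - 2] vertices off [i], [p] and [q]; with [i] and [p] they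
    form an edge by [EK]. *)
Lemma link2_poly_gt0 (i : 'I_n.+1) : (i < p)%N -> 0 < link2_poly x E i p.
Proof.
move=> ip; have ipN : i != p by apply/eqP => /(congr1 val) /=; lia.
have iqN : i != q by apply/eqP => /(congr1 val) /=; lia.
have [|B BS Br] := @ex_kset _ (r - 2) (~: [set i; p; q]).
  rewrite cardsCs finset.setCK card_ord; have := cardsU1 i [set p; q]; rewrite -finset.setUA cards2.
  lia.
have [iB pB qB] : [/\ i \notin B, p \notin B & q \notin B].
  by split; apply/negP => /(fintype.subsetP BS); rewrite !inE eqxx ?orbT.
apply: (@wsum_gt0 _ _ _ _ B) => //; rewrite iB pB; apply: EK.
  by rewrite !inE (eq_sym q) (negPf iqN) (eq_sym q) (negPf pq).
rewrite !cardsU1 !inE (negPf ipN) iB pB Br /=; lia.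
Qed.

(* An edge through [i] whose [i] cannot be replaced by [p] contains [q];
   compression then lets [p] replace [q]. *)
Lemma link_poly_le (i : 'I_n.+1) : (i < p)%N ->
  link_poly x E i p <= link_poly x E p i + x ord0 q * link2_poly x E i p.
Proof.
move=> ip; have ipN : i != p by apply/eqP => /(congr1 val) /=; lia.
have iqN : i != q by apply/eqP => /(congr1 val) /=; lia.
rewrite {1}/link_poly (@wsum_split _ _ _ _ q); apply: lerD.
  apply: wsum_le => // A /and4P[qA iA pA AE]; rewrite pA iA; apply: EK.
    by rewrite !inE (eq_sym q) (negPf pq).
  by have := card_edge AE; rewrite !cardsU1 iA pA.
rewrite ler_pM2l //; apply: wsum_le => // A /and4P[qA].
rewrite !in_setU1 (negPf iqN) (negPf pq) /= => -> pA /=; rewrite pA finset.setUCA => AE.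
rewrite finset.setUCA; apply: (left_compressed_swap Er lc) AE => //; first by lia.
  by rewrite !inE (eq_sym p) (negPf ipN).
by rewrite !inE (eq_sym q) (negPf iqN).
Qed.

(** By [optimal_deriv_eq], the difference of the two coordinates times the positive pair link is the
    difference of the link polynomials. Compression makes the latter nonnegative, and [link_poly_le]
    bounds it above. *)
Lemma optimal_coord_bounds (i : 'I_n.+1) : (i < p)%N ->
  x ord0 p <= x ord0 i /\ x ord0 i <= x ord0 p + x ord0 q.
Proof.
move=> ip; have ipN : i != p by apply/eqP => /(congr1 val) /=; lia.
have c0 := link2_poly_gt0 ip; have d := optimal_deriv_eq xo ipN (x0 i) (x0 p).
have le1 := link_poly_le ip.
have le2 : link_poly x E p i <= link_poly x E i p.
  apply: wsum_le => // A /and3P[pA iA AE]; rewrite pA iA.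
  by apply: (left_compressed_swap Er lc) AE => //; exact: ltnW.
split; rewrite -subr_ge0 -(pmulr_lge0 _ c0); lra.
Qed.

Lemma link2E : link2_poly x E p q = wsum x (mem (link2 r E p q)).
Proof.
apply: eq_wsum => A; rewrite /= in_link2.
apply/and3P/andP => [[pA qA AE]|[/eqP Ar AE]].
  split => //; have := card_edge AE; rewrite !cardsU1 !inE (negPf pq) pA qA /=.
  by move=> h; apply/eqP; lia.
have := card_edge AE; rewrite !cardsU1 !inE (negPf pq) Ar.
by case: (p \in A); case: (q \in A) => /=; split => //; lia.
Qed.

(** By [EK], every [(r - 1)]-set avoiding [p] and [q] lies in the link of [p]; removing those in the
    link of [q] leaves its non-edges. *)
Lemma link_poly_diff : link_poly x E p q - link_poly x E q p =
  wsum x (mem (ksets (r - 1) (initial n.+1 (n - 1)) :\: link r E q)).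
Proof.
(* As numbering starts at 0, the vertices below [n - 1] are all but [p] and [q]. *)
have initialE (A : {set 'I_n.+1}) :
    (A \subset initial n.+1 (n - 1)) = (p \notin A) && (q \notin A).
  apply/fintype.subsetP/andP => [AS|[pA qA] k kA].
    by split; apply/negP => /AS; rewrite inE; lia.
  have kp : k != p by apply: contraNneq pA => <-.
  have kq : k != q by apply: contraNneq qA => <-.
  move: kp kq; rewrite !inE -!(inj_eq val_inj) /=; have := ltn_ord k; lia.
rewrite {1}/link_poly (@wsum_bigID _ _ _ _ (fun A => q |: A \in E)).
set D := wsum _ (fun A => _ && ~~ _); set W := wsum _ _; set V := link_poly _ _ _ _.
have -> : W = V.
  apply: eq_wsum => A; apply/andP/and3P => [[/and3P[pA qA _] AE]|[qA pA AE]] //.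
  split => //; rewrite pA qA; apply: EK; first by rewrite !inE (eq_sym q) (negPf pq).
  by have := card_edge AE; rewrite !cardsU1 pA qA.
rewrite addrAC subrr add0r; apply: eq_wsum => A.
rewrite /= finset.in_setD in_link [A \in ksets _ _]inE initialE -subn1.
apply/andP/andP => [[/and3P[pA qA AE] qAE]|[AE /andP[/andP[pA qA] /eqP Ar]]].
  rewrite pA qA (negPf qAE) andbF; split => //.
  by have := card_edge AE; rewrite cardsU1 pA /= => Ar; apply/eqP; lia.
move: AE; rewrite Ar eqxx /= => qAE.
rewrite pA qA; split => //; apply: EK; first by rewrite !inE (eq_sym q) (negPf pq).
by rewrite cardsU1 pA Ar; lia.
Qed.

Lemma link2_eq0 : (2 ^ (r - 3) * #|link2 r E p q|
    <= #|ksets (r - 1) (initial n.+1 (n - 1)) :\: link r E q|)%N ->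
  link2 r E p q = finset.set0.
Proof.
set D := _ :\: _; set B := link2 r E p q; set k := #|B| => kD.
apply/eqP; rewrite -cards_eq0 -leqn0 leqNgt; apply/negP => k0.
set u := x ord0 p; set v := x ord0 q.
have u0 : 0 < u := x0 p; have v0 : 0 < v := x0 q.
have := optimal_deriv_eq xo pq (x0 p) (x0 q).
rewrite link_poly_diff link2E -/D -/B -/u -/v => eqDB.
have small (A : {set 'I_n.+1}) i : p \notin A -> q \notin A -> i \in A -> (i < p)%N.
  move=> pA qA iA; have ip : i != p by apply: contraNneq pA => <-.
  have iq : i != q by apply: contraNneq qA => <-.
  move: ip iq; rewrite -!(inj_eq val_inj) /=; have := ltn_ord i; lia.
have leD : #|D|%:R * u ^+ (r - 1) <= wsum x (mem D).
  rewrite mulr_natl -sumr_const; apply: ler_sum => A.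
  rewrite /= finset.in_setD [A \in ksets _ _]inE => /andP[_].
  case/andP => /fintype.subsetP AS /eqP <-.
  rewrite -prodr_const; apply: ler_prod => i /AS; rewrite inE => ip.
  by rewrite (ltW u0) (optimal_coord_bounds _).1 //; lia.
have leB : wsum x (mem B) <= k%:R * (u + v) ^+ (r - 2).
  rewrite mulr_natl -sumr_const; apply: ler_sum => A; rewrite /= in_link2 => /andP[/eqP Ar AE].
  have /andP[pA qA] : (p \notin A) && (q \notin A).
    have := card_edge AE; rewrite !cardsU1 !inE (negPf pq) Ar.
    by case: (p \in A); case: (q \in A) => //=; lia.
  have -> : (r - 2 = #|A|)%N by lia.
  rewrite -prodr_const; apply: ler_prod => i iA.
  by rewrite x0' (optimal_coord_bounds _).2 // (small A).
have D0 : 0 < #|D|%:R * u ^+ (r - 1).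
  rewrite mulr_gt0 ?exprn_gt0 // ltr0n; apply: leq_trans kD.
  by rewrite muln_gt0 expn_gt0.
(* Otherwise the right side of [eqDB] would be at most 0, while its left side is positive by [leD]
   and [D0]. *)
have vu : v < u.
  rewrite ltNge; apply/negP => uv.
  have : (u - v) * wsum x (mem B) <= 0 by apply: mulr_le0_ge0; [lra | exact: wsum_ge0].
  lra.
have kD' : (2 ^+ (r - 3) * k%:R) <= #|D|%:R :> R by rewrite -natrX -natrM ler_nat.
have k0' : 0 < k%:R :> R by rewrite ltr0n.
have uv3 : (u + v) ^+ (r - 3) <= 2 ^+ (r - 3) * u ^+ (r - 3).
  rewrite -exprMn lerXn2r // ?nnegrE; lra.
have : (u - v) * wsum x (mem B) < #|D|%:R * u ^+ (r - 1).
  apply: le_lt_trans (_ : (u - v) * (k%:R * (u + v) ^+ (r - 2)) < _).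
    by rewrite ler_pM2l // subr_gt0.
  apply: lt_le_trans (_ : 2 ^+ (r - 3) * k%:R * u ^+ (r - 1) <= _); last first.
    by rewrite ler_pM2r // exprn_gt0.
  (* Splitting off one factor [u + v] and two factors [u] leaves the powers compared in [uv3].
     Strictness comes from [u ^+ 2 - v ^+ 2 < u ^+ 2]. *)
  have -> : (r - 2 = (r - 3).+1)%N by lia.
  have -> : (r - 1 = (r - 3).+2)%N by lia.
  rewrite !exprS; move: uv3; set a := (u + v) ^+ _; set b := 2 ^+ _; set c := u ^+ _ => uv3.
  have bc : 0 < b * c by rewrite mulr_gt0 ?exprn_gt0.
  have -> : (u - v) * (k%:R * ((u + v) * a)) = k%:R * ((u ^+ 2 - v ^+ 2) * a) by ring.
  have -> : b * k%:R * (u * (u * c)) = k%:R * (u ^+ 2 * (b * c)) by ring.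
  rewrite ltr_pM2l //; apply: le_lt_trans (_ : (u ^+ 2 - v ^+ 2) * (b * c) < _).
    by apply: ler_wpM2l => //; nra.
  by rewrite ltr_pM2r //; nra.
lra.
Qed.

End LastTwoVertices.

(** * Upper bound for the Lagrangian, and the two cases of the theorem *)

Lemma lagrangian_le_complete (R : realType) (n r : nat) (E : {set {set 'I_n.+1}})
    (p q : 'I_n.+1) : (3 <= r)%N -> (r < n)%N -> uniform r E ->
  left_compressed r E -> p = n.-1 :> nat -> q = n :> nat ->
  (forall A : {set 'I_n.+1}, q \notin A -> #|A| = r -> A \in E) ->
  (2 ^ (r - 3) * #|link2 r E p q|
    <= #|ksets (r - 1) (initial n.+1 (n - 1)) :\: link r E q|)%N ->
  lagrangian R E <= lagrangian R (complete n r).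
Proof.
move=> r3 rn Er lc pE qE EK card; have n0 : (0 < n)%N by lia.
have [x xo] := optimal_exists R E (ltn0Sn _); have [xS _] := xo.
rewrite (optimal_lagrangian xo).
have [/existsP[i /eqP xi]|] := boolP [exists i, x ord0 i == 0].
  by apply: lagr_restr_le xi.
rewrite negb_exists => /forallP xN0.
have x0 i : 0 < x ord0 i by rewrite lt_neqAle eq_sym xN0 xS.2.
have x0' i : 0 <= x ord0 i by exact: ltW.
have pq : q != p by apply/eqP => /(congr1 val) /=; lia.
have := link2E r3 rn Er pE qE x.
rewrite (link2_eq0 r3 rn Er lc pE qE EK xo x0 card) => c0.
have {}c0 : link2_poly x E q p = 0 by rewrite link2_poly_sym c0 /wsum big_set0.
(* Without the mixed term the polynomial is affine along this move. Compression makes the link of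
   [p] dominate that of [q], so moving all the weight of [q] loses nothing and creates a zero
   coordinate. *)
have yS := move_weight_simplex p xS (x0' q) (lexx _).
set y := move_weight x q p _ in yS.
have le : lagr_poly E x <= lagr_poly E y.
  rewrite lagr_move_weight // (lagr_split _ _ pq) c0 subrr.
  have : x ord0 q * link_poly x E q p <= x ord0 q * link_poly x E p q.
    rewrite ler_pM2l //; apply: wsum_le => // A /and3P[qA pA AE]; rewrite qA pA.
    by apply: (left_compressed_swap Er lc) AE => //; lia.
  lra.
apply: (le_trans le); apply: (@lagr_restr_le _ _ _ q) => //.
by rewrite mxE eqxx (negPf pq) mul0r mul1r addr0 subrr.
Qed.

(** Pointwise smaller values stay below [n], so the added edges need no others. *)
Lemma left_compressedU_complete (n r : nat) (E : {set {set 'I_n.+1}}) :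
  left_compressed r E -> left_compressed r (E :|: ksets r (initial n.+1 n)).
Proof.
move=> lc i j iinj jinj ij; rewrite inE => /orP[jE|]; first by rewrite inE (lc i j).
rewrite 2!inE => /andP[/fintype.subsetP jS _]; rewrite !inE card_imset // card_ord eqxx andbT.
apply/orP; right; apply/fintype.subsetP => _ /imsetP[k _ ->].
have : j k \in initial n.+1 n by apply: jS; exact: imset_f.
by rewrite !inE; apply: leq_ltn_trans.
Qed.

(* p and q are the vertices l - 1 and l of the paper (vertices start at 0) *)
Theorem theorem3p4 (R : realType) (r l : nat) (hr : (3 <= r)%N)
  (hl : (r + 2 <= l)%N) (E : {set {set 'I_l}}) (hE : uniform r E)
  (hlc : left_compressed r E)
  (p q : 'I_l) (hp : nat_of_ord p = (l - 2)%N) (hq : nat_of_ord q = (l - 1)%N)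
  (hcard : (2 ^ (r - 3) * #|link2 r E p q|
            <= #|ksets (r - 1) (initial l (l - 2)) :\: link r E q|)%N) :
  (ksets r (initial l (l - 1)) \subset E ->
     lagrangian R E = lagrangian R (complete (l - 1) r)) /\
  (~~ (ksets r (initial l (l - 1)) \subset E) ->
     lagrangian R E < lagrangian R (complete (l - 1) r)).
Proof.
case: l hl E hE hlc p q hp hq hcard => [|n] hl E hE hlc p q hp hq; first by case: p hp.
rewrite !subSS subn0 in hq * => hcard; have n0 : (0 < n)%N by lia.
have {}hp : p = n.-1 :> nat by lia.
have rn : (r < n)%N by lia.
have pq : p != q by apply/eqP => /(congr1 val) /=; lia.
have initialE (A : {set 'I_n.+1}) :
    (A \in ksets r (initial n.+1 n)) = (q \notin A) && (#|A| == r).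
  rewrite inE; congr (_ && _); apply/fintype.subsetP/idP => [AS|qA k kA].
    by apply/negP => /AS; rewrite inE; lia.
  have kq : k != q by apply: contraNneq qA => <-.
  move: kq; rewrite !inE -!(inj_eq val_inj) /=; have := ltn_ord k; lia.
have main (F : {set {set 'I_n.+1}}) : uniform r F -> left_compressed r F ->
    (2 ^ (r - 3) * #|link2 r F p q|
      <= #|ksets (r - 1) (initial n.+1 (n - 1)) :\: link r F q|)%N ->
    ksets r (initial n.+1 n) \subset F -> lagrangian R F = lagrangian R (complete n r).
  move=> Fr Flc Fcard /fintype.subsetP FK.
  have {}FK (A : {set 'I_n.+1}) : q \notin A -> #|A| = r -> A \in F.
    by move=> qA Ar; apply: FK; rewrite initialE qA Ar eqxx.
  apply/eqP; rewrite eq_le (lagrangian_le_complete _ hr rn Fr Flc hp hq) //.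
  exact: (@lagrangian_ge_complete _ _ _ q).
split; first exact: main.
case/fintype.subsetPn => A0 A0K A0E.
pose F := E :|: ksets r (initial n.+1 n).
(* The added edges avoid [q], so the cardinality hypothesis passes from [E] to [F] unchanged. *)
have FE (A : {set 'I_n.+1}) : q \in A -> (A \in F) = (A \in E).
  by move=> qA; rewrite finset.in_setU initialE qA orbF.
have FK : lagrangian R F = lagrangian R (complete n r).
  apply: main; last exact: finset.subsetUr.
  - rewrite /uniform finset.subUset hE /=; apply/fintype.subsetP => A.
    by rewrite initialE in_complete => /andP[].
  - exact: left_compressedU_complete.
  have -> : link2 r F p q = link2 r E p q.
    by apply/setP => A; rewrite !in_link2 FE // !inE eqxx orbT.
  suff -> : link r F q = link r E q by [].
  by apply/setP => A; rewrite !in_link FE // setU11.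
have [x xo] := optimal_exists R E (ltn0Sn _); have [xS _] := xo.
rewrite -FK (optimal_lagrangian xo).
have [/existsP[i /eqP xi]|] := boolP [exists i, x ord0 i == 0].
  rewrite FK ltNge; apply/negP => le.
  have Ei := clique_of_lagrangian_ge hE (ltnW hr) (ltnW rn) xS xi le.
  move: A0K; rewrite initialE => /andP[qA0 /eqP A0r].
  have [iA0|iA0] := boolP (i \in A0); last by rewrite Ei in A0E.
  (* Replacing [i] by [q] in [A0] gives a set off [i], hence an edge by [Ei]; compressing [q] back
     to [i] makes [A0] an edge. *)
  have qi : q != i by apply: contraNneq qA0 => ->.
  suff : i |: (A0 :\ i) \in E by rewrite finset.setD1K // (negPf A0E).
  have iD : i \notin A0 :\ i by rewrite !inE eqxx.
  have qD : q \notin A0 :\ i by rewrite !inE (negPf qA0) andbF.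
  apply: (@left_compressed_swap _ _ _ i q _ hE hlc) => //; first by have := ltn_ord i; lia.
  apply: Ei; first by rewrite !inE eqxx (eq_sym i) (negPf qi).
  by rewrite cardsU1 qD -A0r (cardsD1 i A0) iA0.
rewrite negb_exists => /forallP xN0.
have x0 i : 0 < x ord0 i by rewrite lt_neqAle eq_sym xN0 xS.2.
(* With all coordinates positive, the missing edge [A0] makes the value of [F] at [x] strictly
   larger than that of [E]. *)
have [y yo] := optimal_exists R F (ltn0Sn _).
rewrite (optimal_lagrangian yo); apply: lt_le_trans (yo.2 _ xS).
apply: lagr_lt => //; apply/fintype.properP; split; first exact: finset.subsetUl.
by exists A0; rewrite // finset.in_setU A0K orbT.
Qed.
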